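(* Every Ptolemy metric space $(X,d)$ admits an isometric embedding into a Ptolemy metric space $(Y,d_Y)$ with the property that any three points of $Y$ lie on a circle in $Y$.
   Context: A metric space $(X,d)$ is Ptolemy if $d(x,y)d(z,w)\le d(x,z)d(y,w)+d(x,w)d(y,z)$ for all $x,y,z,w\in X$. A circle in a Ptolemy metric space $Y$ is a subset $\sigma$ homeomorphic to $S^1$ such that for all distinct $x,y,z,w\in\sigma$ with $y,w$ in different components of $\sigma\setminus\{x,z\}$, $d_Y(x,z)d_Y(y,w)=d_Y(x,y)d_Y(z,w)+d_Y(x,w)d_Y(y,z)$. *)

(* Defs.v *)
From Stdlib Require Import Reals.
Open Scope R_scope.

Record MetricSpace := {
  carrier :> Type;
  dist : carrier -> carrier -> R;
  dist_nonneg : forall x y, 0 <= dist x y;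
  dist_self : forall x, dist x x = 0;
  dist_eq0 : forall x y, dist x y = 0 -> x = y;
  dist_sym : forall x y, dist x y = dist y x;
  dist_triangle : forall x y z, dist x z <= dist x y + dist y z
}.

Arguments dist {m} _ _.

Definition Ptolemy (X : MetricSpace) : Prop :=
  forall x y z w : X,
    dist x y * dist z w <= dist x z * dist y w + dist x w * dist y z.

Definition isometric_embedding {X Y : MetricSpace} (f : X -> Y) : Prop :=
  forall a b : X, dist (f a) (f b) = dist a b.

Definition rel_open {Y : MetricSpace} (A U : Y -> Prop) : Prop :=
  forall x, A x -> U x ->
    exists eps, 0 < eps /\ forall y, A y -> dist x y < eps -> U y.

Definition connected_set {Y : MetricSpace} (A : Y -> Prop) : Prop :=
  forall U V : Y -> Prop,
    rel_open A U -> rel_open A V ->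
    (forall x, A x -> U x \/ V x) ->
    (forall x, A x -> U x -> V x -> False) ->
    (exists x, A x /\ U x) -> (exists x, A x /\ V x) -> False.

Definition same_component {Y : MetricSpace} (A : Y -> Prop) (y w : Y) : Prop :=
  exists C : Y -> Prop,
    (forall x, C x -> A x) /\ connected_set C /\ C y /\ C w.

Definition S1 : Type := {p : R * R | fst p ^ 2 + snd p ^ 2 = 1}.

Definition S1_dist (p q : S1) : R :=
  sqrt ((fst (proj1_sig p) - fst (proj1_sig q)) ^ 2 +
        (snd (proj1_sig p) - snd (proj1_sig q)) ^ 2).

Definition homeomorphic_to_S1 {Y : MetricSpace} (sigma : Y -> Prop) : Prop :=
  exists f : S1 -> Y,
    (forall p, sigma (f p)) /\
    (forall y, sigma y -> exists p, f p = y) /\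
    (forall p q, f p = f q -> p = q) /\
    (forall p eps, 0 < eps -> exists delta, 0 < delta /\
        forall q, S1_dist p q < delta -> dist (f p) (f q) < eps) /\
    (forall p eps, 0 < eps -> exists delta, 0 < delta /\
        forall q, dist (f p) (f q) < delta -> S1_dist p q < eps).

Definition is_circle {Y : MetricSpace} (sigma : Y -> Prop) : Prop :=
  homeomorphic_to_S1 sigma /\
  forall x y z w : Y,
    sigma x -> sigma y -> sigma z -> sigma w ->
    x <> y -> x <> z -> x <> w -> y <> z -> y <> w -> z <> w ->
    ~ same_component (fun u => sigma u /\ u <> x /\ u <> z) y w ->
    dist x z * dist y w = dist x y * dist z w + dist x w * dist y z.

(* Main.v *)
(** A point m = (1-t)x + ty of an added segment [x,y] is declared to be at distance
    (1-t)d(x,u) + t d(y,u) from every point u off that segment. The Ptolemy inequality is affine in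
    each point whose segment contains none of the other three, and the remaining configurations
    reduce to the real line, so it survives adding all segments between pairs of points at once; a
    point at infinity, at distance 1 from everything, turns the triangle inequality into an instance
    of it. Iterating countably often and identifying points at distance 0 gives Y.

    A triangle made of fresh segments is a circle. Choosing scales with l_i l_j = d(v_i,v_j), its
    points correspond to the lines of the plane, in such a way that
    d(p,q) = rho(p) rho(q) |det(u_p,u_q)| for vectors u_p, u_q spanning these lines. Half angles
    identify the lines with S^1 and |det| with half the chord length, so that the parametrization by
    S^1 is bi-Lipschitz, and the Ptolemy equality is the Pluecker relation for the determinants. *)

From Stdlib Require Import Reals Ranalysis5 Lra Lia PeanoNat.
From Stdlib Require Import ClassicalEpsilon ProofIrrelevance FunctionalExtensionality.
Require Import Defs.
Open Scope R_scope.

(** * Adding segments to a Ptolemaic distance *)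

Lemma le_sub_nonneg (x y : R) : x <= y -> 0 <= y - x.
Proof. lra. Qed.

(** All three pairings are kept, so that for symmetric [d] the property is invariant under permuting
    the points and case distinctions can be made up to order. *)
Definition ptolemy4 {S : Type} (d : S -> S -> R) (a b c e : S) : Prop :=
  d a b * d c e <= d a c * d b e + d a e * d b c /\
  d a c * d b e <= d a b * d c e + d a e * d b c /\
  d a e * d b c <= d a b * d c e + d a c * d b e.

(** Distinct points at distance 0 are tolerated until the final quotient, and the triangle
    inequality will come from the point at infinity. *)
Record ptolemaic {S : Type} (d : S -> S -> R) : Prop := {
  pt_nonneg : forall a b, 0 <= d a b;
  pt_self : forall a, d a a = 0;
  pt_sym : forall a b, d a b = d b a;
  pt_ineq : forall a b c e, ptolemy4 d a b c e
}.

Record segpt (S : Type) := SegPt { lft : S; rgt : S; prm : R }.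
Arguments SegPt {S}. Arguments lft {S}. Arguments rgt {S}. Arguments prm {S}.

Definition on_seg {S : Type} (P : segpt S) : Prop := 0 <= prm P <= 1.

Definition pure {S : Type} (x : S) : segpt S := SegPt x x 0.

Definition same_seg {S : Type} (P Q : segpt S) : Prop := lft P = lft Q /\ rgt P = rgt Q.

Definition bilin {S : Type} (d : S -> S -> R) (P Q : segpt S) : R :=
  (1 - prm P) * ((1 - prm Q) * d (lft P) (lft Q) + prm Q * d (lft P) (rgt Q)) +
  prm P * ((1 - prm Q) * d (rgt P) (lft Q) + prm Q * d (rgt P) (rgt Q)).

(** Segments count as ordered pairs: those from x to y and from y to x are different when x and y
    differ, and the bilinear formula then applies between them. *)
Definition segdist {S : Type} (d : S -> S -> R) (P Q : segpt S) : R :=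
  if excluded_middle_informative (same_seg P Q)
  then Rabs (prm P - prm Q) * d (lft P) (rgt P)
  else bilin d P Q.

Section SegDist.

Variables (S : Type) (d : S -> S -> R).
Hypothesis hd : ptolemaic d.

Local Notation D := (segdist d).

Lemma segdist_same (P Q : segpt S) :
  same_seg P Q -> D P Q = Rabs (prm P - prm Q) * d (lft P) (rgt P).
Proof.
  intros h; unfold segdist; destruct excluded_middle_informative; tauto.
Qed.

Lemma segdist_other (P Q : segpt S) : ~ same_seg P Q -> D P Q = bilin d P Q.
Proof.
  intros h; unfold segdist; destruct excluded_middle_informative; tauto.
Qed.

(** The two branches of [segdist] agree here: if [P] is on the degenerate segment at [z], both sides
    vanish because [d z z = 0]. *)
Lemma segdist_pure_r (P : segpt S) (z : S) :
  D P (pure z) = (1 - prm P) * d (lft P) z + prm P * d (rgt P) z.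
Proof.
  unfold segdist; destruct excluded_middle_informative as [[h1 h2]|h].
  - simpl in *; rewrite h1, h2, (pt_self d hd); ring.
  - unfold bilin; simpl; ring.
Qed.

Lemma segdist_sym (P Q : segpt S) : D P Q = D Q P.
Proof.
  destruct (excluded_middle_informative (same_seg P Q)) as [h|h].
  - rewrite (segdist_same P Q h), (segdist_same Q P).
    + destruct h as [-> ->]; rewrite Rabs_minus_sym; reflexivity.
    + destruct h; split; auto.
  - rewrite (segdist_other P Q h), (segdist_other Q P).
    + unfold bilin.
      rewrite (pt_sym d hd (lft Q) (lft P)), (pt_sym d hd (lft Q) (rgt P)),
        (pt_sym d hd (rgt Q) (lft P)), (pt_sym d hd (rgt Q) (rgt P)); ring.
    + intros [h1 h2]; apply h; split; auto.
Qed.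

Lemma segdist_pure (x y : S) : D (pure x) (pure y) = d x y.
Proof. rewrite segdist_pure_r; simpl; ring. Qed.

Lemma segdist_nonneg (P Q : segpt S) : on_seg P -> on_seg Q -> 0 <= D P Q.
Proof.
  intros hP hQ; unfold on_seg in *; unfold segdist.
  pose proof (pt_nonneg d hd) as n.
  destruct excluded_middle_informative.
  - apply Rmult_le_pos; [apply Rabs_pos | apply n].
  - assert (hP' : 0 <= 1 - prm P) by lra; assert (hQ' : 0 <= 1 - prm Q) by lra.
    unfold bilin; destruct hP as [hP _], hQ as [hQ _].
    apply Rplus_le_le_0_compat; apply Rmult_le_pos; auto;
      apply Rplus_le_le_0_compat; apply Rmult_le_pos; auto.
Qed.

Lemma segdist_self (P : segpt S) : D P P = 0.
Proof.
  rewrite segdist_same by (split; reflexivity).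
  rewrite Rminus_diag, Rabs_R0; ring.
Qed.

Lemma segdist_affine (P Q : segpt S) :
  ~ same_seg P Q ->
  D P Q = (1 - prm P) * D (pure (lft P)) Q + prm P * D (pure (rgt P)) Q.
Proof.
  intros h.
  rewrite (segdist_sym (pure (lft P))), (segdist_sym (pure (rgt P))), !segdist_pure_r.
  rewrite (segdist_other _ _ h); unfold bilin.
  rewrite (pt_sym d hd (lft Q) (lft P)), (pt_sym d hd (lft Q) (rgt P)),
    (pt_sym d hd (rgt Q) (lft P)), (pt_sym d hd (rgt Q) (rgt P)); ring.
Qed.

Lemma segdist_affine_pure (P : segpt S) (z : S) :
  D P (pure z) = (1 - prm P) * D (pure (lft P)) (pure z) + prm P * D (pure (rgt P)) (pure z).
Proof. rewrite segdist_pure_r, !segdist_pure; reflexivity. Qed.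

Lemma ptolemy4_swap (a b c e : segpt S) : ptolemy4 D a b c e -> ptolemy4 D b a c e.
Proof.
  unfold ptolemy4; rewrite (segdist_sym b a); lra.
Qed.

Lemma ptolemy4_rot (a b c e : segpt S) : ptolemy4 D a b c e -> ptolemy4 D b c e a.
Proof.
  unfold ptolemy4.
  rewrite (segdist_sym b a), (segdist_sym c a), (segdist_sym e a); lra.
Qed.

(** This covers two situations at once: [P] and [Q] on different segments, and [Q] an old point,
    where no condition on the segments is required. *)
Definition affine_at (P Q : segpt S) : Prop :=
  D P Q = (1 - prm P) * D (pure (lft P)) Q + prm P * D (pure (rgt P)) Q.

(** Each term of the three inequalities contains exactly one distance from [a], so they are convex
    combinations of the inequalities at the two ends. *)
Lemma ptolemy4_affine (a b c e : segpt S) :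
  on_seg a -> affine_at a b -> affine_at a c -> affine_at a e ->
  ptolemy4 D (pure (lft a)) b c e -> ptolemy4 D (pure (rgt a)) b c e ->
  ptolemy4 D a b c e.
Proof.
  intros [h0 h1] hb hc he [x1 [x2 x3]] [y1 [y2 y3]]; unfold ptolemy4.
  rewrite hb, hc, he.
  apply le_sub_nonneg in x1, x2, x3, y1, y2, y3.
  assert (h1' : 0 <= 1 - prm a) by lra.
  pose proof (Rmult_le_pos _ _ h1' x1); pose proof (Rmult_le_pos _ _ h1' x2);
  pose proof (Rmult_le_pos _ _ h1' x3); pose proof (Rmult_le_pos _ _ h0 y1);
  pose proof (Rmult_le_pos _ _ h0 y2); pose proof (Rmult_le_pos _ _ h0 y3).
  repeat split; lra.
Qed.

(** The determinant [ac * be - ae * bc] equals [(t - s) * (xc * ye - xe * yc)], which gives the last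
    two inequalities. For the first, [ac * be + ae * bc] exceeds [(t - s) * (xc * ye + xe * yc)] by
    a nonnegative combination of products of distances. *)
Lemma affine_on_two_points (s t xy ce xc xe yc ye : R) :
  0 <= s -> s <= t -> t <= 1 -> 0 <= xc -> 0 <= xe -> 0 <= yc -> 0 <= ye ->
  xy * ce <= xc * ye + xe * yc -> xc * ye <= xy * ce + xe * yc -> xe * yc <= xy * ce + xc * ye ->
  let ac := (1 - s) * xc + s * yc in let ae := (1 - s) * xe + s * ye in
  let bc := (1 - t) * xc + t * yc in let be := (1 - t) * xe + t * ye in
  (t - s) * xy * ce <= ac * be + ae * bc /\
  ac * be <= (t - s) * xy * ce + ae * bc /\
  ae * bc <= (t - s) * xy * ce + ac * be.
Proof.
  intros hs hst ht c1 c2 c3 c4 p1 p2 p3 ac ae bc be.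
  assert (hts : 0 <= t - s) by lra.
  assert (0 <= (1 - s) * (1 - t) * (xc * xe)) by (repeat apply Rmult_le_pos; lra).
  assert (0 <= s * t * (yc * ye)) by (repeat apply Rmult_le_pos; lra).
  assert (0 <= s * (1 - t) * (xc * ye + xe * yc)).
  { assert (0 <= xc * ye) by (apply Rmult_le_pos; lra).
    assert (0 <= xe * yc) by (apply Rmult_le_pos; lra).
    repeat apply Rmult_le_pos; lra. }
  assert (q1 : 0 <= (t - s) * (xc * ye + xe * yc - xy * ce)) by (apply Rmult_le_pos; lra).
  assert (q2 : 0 <= (t - s) * (xy * ce + xe * yc - xc * ye)) by (apply Rmult_le_pos; lra).
  assert (q3 : 0 <= (t - s) * (xy * ce + xc * ye - xe * yc)) by (apply Rmult_le_pos; lra).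
  unfold ac, ae, bc, be; repeat split; lra.
Qed.

Lemma ptolemy4_pair (a b c e : segpt S) :
  on_seg a -> on_seg b -> on_seg c -> on_seg e -> same_seg a b ->
  affine_at a c -> affine_at a e -> affine_at b c -> affine_at b e ->
  ptolemy4 D (pure (lft a)) (pure (rgt a)) c e -> ptolemy4 D a b c e.
Proof.
  intros ha hb hc he hab ac ae bc be.
  assert (ab := segdist_same a b hab).
  destruct hab as [hl hr]; unfold affine_at in *; rewrite <- hl, <- hr in *.
  rewrite <- (segdist_pure (lft a) (rgt a)) in ab.
  unfold ptolemy4; rewrite ab, ac, ae, bc, be; intros [p1 [p2 p3]].
  pose proof (fun x P h => segdist_nonneg (pure x) P (conj (Rle_refl 0) Rle_0_1) h) as n.
  destruct ha as [a0 a1], hb as [b0 b1].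
  destruct (Rle_dec (prm a) (prm b)) as [hst|hst].
  - rewrite Rabs_left1 by lra.
    pose proof (affine_on_two_points (prm a) (prm b) _ _ _ _ _ _ a0 hst b1
      (n (lft a) c hc) (n (lft a) e he) (n (rgt a) c hc) (n (rgt a) e he) p1 p2 p3) as q.
    cbv zeta in q; lra.
  - rewrite Rabs_right by lra.
    apply Rnot_le_lt, Rlt_le in hst.
    pose proof (affine_on_two_points (prm b) (prm a) _ _ _ _ _ _ b0 hst a1
      (n (lft a) c hc) (n (lft a) e he) (n (rgt a) c hc) (n (rgt a) e he) p1 p2 p3) as q.
    cbv zeta in q; lra.
Qed.

(** With [f] affine, [f 0 = u] and [f 1 = v], one has [(r - s) * f t = (r - t) * f s + (t - s) * f
    r]; take absolute values, [f] being nonnegative on the unit interval. This is the case of three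
    points on one segment and a fourth elsewhere. *)
Lemma line_ptolemy_affine (r s t u v : R) :
  0 <= r <= 1 -> 0 <= s <= 1 -> 0 <= t <= 1 -> 0 <= u -> 0 <= v ->
  Rabs (r - s) * ((1 - t) * u + t * v) <=
  Rabs (r - t) * ((1 - s) * u + s * v) + ((1 - r) * u + r * v) * Rabs (s - t).
Proof.
  intros hr hs ht hu hv.
  assert (n : forall x y, 0 <= x <= 1 -> 0 <= Rabs y * ((1 - x) * u + x * v)).
  { intros x y hx; apply Rmult_le_pos; [apply Rabs_pos |].
    apply Rplus_le_le_0_compat; apply Rmult_le_pos; lra. }
  pose proof (n s (r - t) hs) as n1; pose proof (n r (s - t) hr) as n2; revert n1 n2.
  clear n; unfold Rabs; repeat destruct Rcase_abs; intros; lra.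
Qed.

Lemma ptolemy4_triple (a b c e : segpt S) :
  on_seg a -> on_seg b -> on_seg c -> on_seg e -> same_seg a b -> same_seg a c ->
  affine_at a e -> affine_at b e -> affine_at c e -> ptolemy4 D a b c e.
Proof.
  intros ha hb hc he hab hac ae be ce.
  assert (ab := segdist_same a b hab).
  assert (ac := segdist_same a c hac).
  assert (bc : D b c = Rabs (prm b - prm c) * d (lft a) (rgt a)).
  { destruct hab as [h1 h2], hac as [h3 h4].
    rewrite segdist_same by (split; congruence); rewrite h1, h2; reflexivity. }
  destruct hab as [hl hr], hac as [hl' hr']; unfold affine_at in *.
  rewrite <- hl, <- hr in be; rewrite <- hl', <- hr' in ce.
  unfold ptolemy4; rewrite ab, ac, bc, ae, be, ce.
  pose proof (fun x P h => segdist_nonneg (pure x) P (conj (Rle_refl 0) Rle_0_1) h) as n.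
  pose proof (n (lft a) e he) as nl; pose proof (n (rgt a) e he) as nr.
  pose proof (pt_nonneg d hd (lft a) (rgt a)) as nd.
  set (u := D (pure (lft a)) e) in *; set (v := D (pure (rgt a)) e) in *.
  pose proof (line_ptolemy_affine (prm a) (prm b) (prm c) u v ha hb hc nl nr) as q1.
  pose proof (line_ptolemy_affine (prm a) (prm c) (prm b) u v ha hc hb nl nr) as q2.
  pose proof (line_ptolemy_affine (prm b) (prm c) (prm a) u v hb hc ha nl nr) as q3.
  rewrite (Rabs_minus_sym (prm c) (prm b)) in q2.
  rewrite (Rabs_minus_sym (prm b) (prm a)), (Rabs_minus_sym (prm c) (prm a)) in q3.
  apply le_sub_nonneg in q1, q2, q3.
  pose proof (Rmult_le_pos _ _ nd q1); pose proof (Rmult_le_pos _ _ nd q2);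
  pose proof (Rmult_le_pos _ _ nd q3).
  repeat split; lra.
Qed.

(** It serves four points on one segment, and later shows that the real line is Ptolemy. *)
Lemma line_ptolemy (r s t u : R) :
  Rabs (r - s) * Rabs (t - u) <= Rabs (r - t) * Rabs (s - u) + Rabs (r - u) * Rabs (s - t).
Proof.
  rewrite <- !Rabs_mult.
  replace ((r - s) * (t - u)) with ((r - t) * (s - u) + - ((r - u) * (s - t))) by ring.
  eapply Rle_trans; [apply Rabs_triang | rewrite Rabs_Ropp; lra].
Qed.

Lemma ptolemy4_quadruple (a b c e : segpt S) :
  same_seg a b -> same_seg a c -> same_seg a e -> ptolemy4 D a b c e.
Proof.
  intros [ab1 ab2] [ac1 ac2] [ae1 ae2].
  unfold ptolemy4; rewrite !segdist_same by (split; congruence).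
  rewrite <- ab1, <- ab2, <- ac1, <- ac2.
  pose proof (pt_nonneg d hd (lft a) (rgt a)) as nd.
  set (k := d (lft a) (rgt a)) in *.
  pose proof (Rmult_le_pos _ _ nd nd) as nk.
  pose proof (line_ptolemy (prm a) (prm b) (prm c) (prm e)) as q1.
  pose proof (line_ptolemy (prm a) (prm c) (prm b) (prm e)) as q2.
  pose proof (line_ptolemy (prm a) (prm e) (prm b) (prm c)) as q3.
  rewrite (Rabs_minus_sym (prm c) (prm b)) in q2.
  rewrite (Rabs_minus_sym (prm e) (prm b)), (Rabs_minus_sym (prm e) (prm c)) in q3.
  apply le_sub_nonneg in q1, q2, q3.
  pose proof (Rmult_le_pos _ _ nk q1); pose proof (Rmult_le_pos _ _ nk q2);
  pose proof (Rmult_le_pos _ _ nk q3).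
  repeat split; lra.
Qed.

Lemma on_seg_pure (x : S) : on_seg (pure x).
Proof. split; simpl; lra. Qed.

(** The number of points inside segments now grows from one to three, each case being reduced to
    fewer such points by moving points to the ends of their segments. *)
Lemma ptolemy4_one (a : segpt S) (x y z : S) :
  on_seg a -> ptolemy4 D a (pure x) (pure y) (pure z).
Proof.
  intros ha; apply ptolemy4_affine; auto; try apply segdist_affine_pure;
    unfold ptolemy4; rewrite !segdist_pure; apply (pt_ineq d hd).
Qed.

Lemma ptolemy4_two (a b : segpt S) (x y : S) :
  on_seg a -> on_seg b -> ptolemy4 D a b (pure x) (pure y).
Proof.
  intros ha hb.
  destruct (excluded_middle_informative (same_seg a b)) as [h|h].
  - apply ptolemy4_pair; auto using on_seg_pure; try apply segdist_affine_pure.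
    apply ptolemy4_one, on_seg_pure.
  - apply ptolemy4_affine; auto; try apply segdist_affine_pure.
    + apply segdist_affine, h.
    + apply ptolemy4_swap, ptolemy4_one, hb.
    + apply ptolemy4_swap, ptolemy4_one, hb.
Qed.

Lemma same_seg_sym (P Q : segpt S) : same_seg P Q -> same_seg Q P.
Proof. intros [h1 h2]; split; auto. Qed.

Lemma same_seg_trans (P Q T : segpt S) : same_seg P Q -> same_seg Q T -> same_seg P T.
Proof. intros [h1 h2] [h3 h4]; split; congruence. Qed.

Lemma ptolemy4_swap34 (a b c e : segpt S) : ptolemy4 D a b c e -> ptolemy4 D a b e c.
Proof.
  intros h; do 2 apply ptolemy4_rot; apply ptolemy4_swap; do 2 apply ptolemy4_rot; exact h.
Qed.

Lemma ptolemy4_swap23 (a b c e : segpt S) : ptolemy4 D a b c e -> ptolemy4 D a c b e.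
Proof.
  intros h; do 3 apply ptolemy4_rot; apply ptolemy4_swap, ptolemy4_rot; exact h.
Qed.

Lemma ptolemy4_isolated (a b c e : segpt S) :
  (forall x, ptolemy4 D b c e (pure x)) ->
  on_seg a -> ~ same_seg a b -> ~ same_seg a c -> ~ same_seg a e -> ptolemy4 D a b c e.
Proof.
  intros h ha hb hc he.
  apply ptolemy4_affine; auto; try (apply segdist_affine; assumption);
    do 3 apply ptolemy4_rot; apply h.
Qed.

(** Either the three points share a segment, or one of them is on a segment without the other two,
    and that one can be moved to its ends. *)
Lemma ptolemy4_three (a b c : segpt S) (x : S) :
  on_seg a -> on_seg b -> on_seg c -> ptolemy4 D a b c (pure x).
Proof.
  intros ha hb hc.
  assert (iso : forall u v w, on_seg u -> on_seg v -> on_seg w ->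
    ~ same_seg u v -> ~ same_seg u w -> ptolemy4 D u v w (pure x)).
  { intros u v w hu hv hw huv huw.
    apply ptolemy4_affine; auto; try (apply segdist_affine; assumption);
      try apply segdist_affine_pure; do 3 apply ptolemy4_rot; apply ptolemy4_two; auto. }
  destruct (excluded_middle_informative (same_seg a b)) as [hab|hab];
    destruct (excluded_middle_informative (same_seg a c)) as [hac|hac].
  - apply ptolemy4_triple; auto using on_seg_pure; apply segdist_affine_pure.
  - apply ptolemy4_swap23, ptolemy4_swap, iso; auto; intros h; apply hac.
    + apply same_seg_sym, h.
    + eapply same_seg_trans; [exact hab | apply same_seg_sym, h].
  - apply ptolemy4_swap, iso; auto; intros h; apply hab.
    + apply same_seg_sym, h.
    + eapply same_seg_trans; [exact hac | apply same_seg_sym, h].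
  - auto.
Qed.

(** The cases are sorted by how many of the points lie on the segment of [a]. The points off that
    segment may share a segment among themselves, which the reduced cases with old points already
    allow. *)
Lemma ptolemy4_segdist (a b c e : segpt S) :
  on_seg a -> on_seg b -> on_seg c -> on_seg e -> ptolemy4 D a b c e.
Proof.
  intros ha hb hc he.
  assert (iso : forall u v w z, on_seg u -> on_seg v -> on_seg w -> on_seg z ->
    ~ same_seg u v -> ~ same_seg u w -> ~ same_seg u z -> ptolemy4 D u v w z).
  { intros; apply ptolemy4_isolated; auto using ptolemy4_three. }
  assert (pair : forall u v w z, on_seg u -> on_seg v -> on_seg w -> on_seg z ->
    same_seg u v -> ~ same_seg u w -> ~ same_seg u z -> ptolemy4 D u v w z).
  { intros u v w z hu hv hw hz huv huw huz.
    apply ptolemy4_pair; auto; try (apply segdist_affine; auto).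
    - intros h; exact (huw (same_seg_trans u v w huv h)).
    - intros h; exact (huz (same_seg_trans u v z huv h)).
    - do 2 apply ptolemy4_rot; apply ptolemy4_two; auto. }
  assert (triple : forall u v w z, on_seg u -> on_seg v -> on_seg w -> on_seg z ->
    same_seg u v -> same_seg u w -> ~ same_seg u z -> ptolemy4 D u v w z).
  { intros u v w z hu hv hw hz huv huw huz.
    apply ptolemy4_triple; auto; apply segdist_affine; auto; intros h; apply huz.
    - exact (same_seg_trans u v z huv h).
    - exact (same_seg_trans u w z huw h). }
  destruct (excluded_middle_informative (same_seg a b)) as [ab|ab];
  destruct (excluded_middle_informative (same_seg a c)) as [ac|ac];
  destruct (excluded_middle_informative (same_seg a e)) as [ae|ae].
  - apply ptolemy4_quadruple; auto.
  - auto.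
  - apply ptolemy4_swap34; auto.
  - auto.
  - apply ptolemy4_swap23, ptolemy4_swap34; auto.
  - apply ptolemy4_swap23; auto.
  - apply ptolemy4_swap23, ptolemy4_swap34, ptolemy4_swap23; auto.
  - auto.
Qed.

End SegDist.

(** Pulling back along [v] lets all stages of the iteration live on one type of points. *)
Lemma ptolemaic_segdist {S T : Type} (d : S -> S -> R) (v : T -> segpt S) :
  ptolemaic d -> (forall x, on_seg (v x)) -> ptolemaic (fun x y => segdist d (v x) (v y)).
Proof.
  intros hd hv; split; intros.
  - apply segdist_nonneg; auto.
  - apply segdist_self; auto.
  - apply segdist_sym; auto.
  - apply ptolemy4_segdist; auto.
Qed.

(** * Circles parametrized by plane vectors *)

Definition det (c s c' s' : R) : R := c * s' - s * c'.

Definition norm1 (c s : R) : R := Rabs c + Rabs s.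

(** For [p] at angle theta between -pi (excluded) and pi, [half_cos] and [half_sin] are the cosine
    and sine of theta / 2. Their sign jumps at (-1, 0), which is harmless since only the line
    spanned by the vector matters. *)
Definition half_cos (p : S1) : R := sqrt ((1 + fst (proj1_sig p)) / 2).
Definition half_sin (p : S1) : R :=
  if Rle_dec 0 (snd (proj1_sig p)) then sqrt ((1 - fst (proj1_sig p)) / 2)
  else - sqrt ((1 - fst (proj1_sig p)) / 2).

Lemma half_angle (p : S1) :
  let c := half_cos p in let s := half_sin p in
  c ^ 2 + s ^ 2 = 1 /\ c ^ 2 - s ^ 2 = fst (proj1_sig p) /\ 2 * c * s = snd (proj1_sig p).
Proof.
  destruct p as [[x y] h]; unfold half_cos, half_sin; simpl fst in *; simpl snd in *.
  assert (hx : -1 <= x <= 1) by (split; nra).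
  assert (e1 := sqrt_sqrt ((1 + x) / 2) ltac:(lra)).
  assert (e2 := sqrt_sqrt ((1 - x) / 2) ltac:(lra)).
  assert (n1 := sqrt_pos ((1 + x) / 2)); assert (n2 := sqrt_pos ((1 - x) / 2)).
  set (c := sqrt ((1 + x) / 2)) in *; set (s := sqrt ((1 - x) / 2)) in *.
  assert (hy : (2 * c * s) * (2 * c * s) = y * y).
  { replace (2 * c * s * (2 * c * s)) with (4 * (c * c) * (s * s)) by ring.
    rewrite e1, e2; nra. }
  assert (hcs : 0 <= c * s) by (apply Rmult_le_pos; auto).
  destruct Rle_dec; cbv zeta; repeat split; try nra.
Qed.

(** The chord of an angle difference is twice the absolute sine of half that difference, and this
    sine is, up to sign, the determinant of the half-angle vectors. *)
Lemma S1_dist_half_angle (p q : S1) :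
  S1_dist p q = 2 * Rabs (det (half_cos p) (half_sin p) (half_cos q) (half_sin q)).
Proof.
  destruct (half_angle p) as [p1 [p2 p3]], (half_angle q) as [q1 [q2 q3]].
  unfold S1_dist; rewrite <- p2, <- p3, <- q2, <- q3.
  set (c := half_cos p) in *; set (s := half_sin p) in *.
  set (c' := half_cos q) in *; set (s' := half_sin q) in *.
  replace (2 * Rabs (det c s c' s')) with (Rabs (2 * det c s c' s'))
    by (rewrite Rabs_mult, (Rabs_right 2) by lra; reflexivity).
  rewrite <- sqrt_Rsqr_abs; f_equal; unfold Rsqr, det.
  replace (2 * (c * s' - s * c') * (2 * (c * s' - s * c')))
    with (4 * (c ^ 2 * s' ^ 2 + s ^ 2 * c' ^ 2 - 2 * (c * s * c' * s'))) by ring.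
  replace ((c ^ 2 - s ^ 2 - (c' ^ 2 - s' ^ 2)) ^ 2 + (2 * c * s - 2 * c' * s') ^ 2)
    with ((c ^ 2 + s ^ 2) ^ 2 + (c' ^ 2 + s' ^ 2) ^ 2
          - 2 * (c ^ 2 - s ^ 2) * (c' ^ 2 - s' ^ 2) - 8 * (c * s * c' * s')) by ring.
  rewrite p1, q1.
  replace (s ^ 2) with (1 - c ^ 2) by lra; replace (s' ^ 2) with (1 - c' ^ 2) by lra; ring.
Qed.

Lemma pos_factor (p q : R) : 0 <= p -> 0 < p * q -> 0 < q.
Proof.
  intros hp h; destruct (Rlt_dec 0 q) as [|hq]; auto; exfalso.
  assert (0 <= p * - q) by (apply Rmult_le_pos; lra); lra.
Qed.

Lemma norm1_pos (c s : R) : c <> 0 \/ s <> 0 <-> 0 < norm1 c s.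
Proof.
  unfold norm1; pose proof (Rabs_pos c); pose proof (Rabs_pos s); split.
  - intros [h|h]; apply Rabs_pos_lt in h; lra.
  - intros h; destruct (Req_dec c 0) as [->|]; [right | auto].
    intros ->; rewrite Rabs_R0 in h; lra.
Qed.

Lemma norm1_unit (c s : R) : c ^ 2 + s ^ 2 = 1 -> 1 <= norm1 c s <= 2.
Proof.
  intros h; unfold norm1.
  pose proof (Rabs_pos c); pose proof (Rabs_pos s).
  rewrite <- (pow2_abs c), <- (pow2_abs s) in h.
  set (a := Rabs c) in *; set (b := Rabs s) in *.
  assert (0 <= a * b) by (apply Rmult_le_pos; auto).
  assert (a <= 1) by nra; assert (b <= 1) by nra.
  split; [| lra].
  assert (0 <= a * (1 - a)) by (apply Rmult_le_pos; lra).
  assert (0 <= b * (1 - b)) by (apply Rmult_le_pos; lra). lra.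
Qed.

Lemma half_angle_surj (c s : R) :
  c <> 0 \/ s <> 0 -> exists p : S1, det (half_cos p) (half_sin p) c s = 0.
Proof.
  intros h.
  assert (hr : 0 < c ^ 2 + s ^ 2) by (destruct h; nra).
  set (r := c ^ 2 + s ^ 2) in *.
  (* Squaring the complex number [c + i s] and dividing by its squared modulus doubles the angle, so
     the half angle returns to the line of [(c, s)]. *)
  assert (hp : fst ((c ^ 2 - s ^ 2) / r, 2 * c * s / r) ^ 2 +
               snd ((c ^ 2 - s ^ 2) / r, 2 * c * s / r) ^ 2 = 1).
  { simpl fst; simpl snd; unfold r in *; field; lra. }
  set (p := exist _ (_, _) hp : S1); exists p.
  destruct (half_angle p) as [h1 [h2 h3]].
  simpl fst in *; simpl snd in *.
  set (c' := half_cos p) in *; set (s' := half_sin p) in *; clearbody c' s'.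
  unfold det; apply Rsqr_0_uniq; unfold Rsqr.
  replace ((c' * s - s' * c) * (c' * s - s' * c))
    with (((c ^ 2 + s ^ 2) * (c' ^ 2 + s' ^ 2) - (c ^ 2 - s ^ 2) * (c' ^ 2 - s' ^ 2)
           - (2 * c * s) * (2 * c' * s')) / 2) by field.
  rewrite h1, h2, h3; unfold r in *; field; lra.
Qed.

Lemma det_le_norm1 (c s c' s' : R) : Rabs (det c s c' s') <= norm1 c s * norm1 c' s'.
Proof.
  unfold det, norm1.
  apply Rle_trans with (Rabs (c * s') + Rabs (s * c')).
  - unfold Rminus; eapply Rle_trans; [apply Rabs_triang | rewrite Rabs_Ropp; lra].
  - rewrite !Rabs_mult.
    pose proof (Rmult_le_pos _ _ (Rabs_pos c) (Rabs_pos c')).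
    pose proof (Rmult_le_pos _ _ (Rabs_pos s) (Rabs_pos s')); lra.
Qed.

(** It extends a path on the unit interval to the whole line with the same image and Lipschitz
    bound, and lets [tree] carry arbitrary real parameters. *)
Definition clip (t : R) : R := Rmax 0 (Rmin 1 t).

Lemma clip_range (t : R) : 0 <= clip t <= 1.
Proof.
  unfold clip; split; [apply Rmax_l | apply Rmax_lub; [lra | apply Rmin_l]].
Qed.

Lemma clip_id (t : R) : 0 <= t <= 1 -> clip t = t.
Proof.
  intros h; unfold clip; rewrite Rmin_right, Rmax_right; lra.
Qed.

Lemma clip_lipschitz (s t : R) : Rabs (clip s - clip t) <= Rabs (s - t).
Proof.
  unfold clip, Rmax, Rmin; repeat destruct Rle_dec;
    unfold Rabs; repeat destruct Rcase_abs; lra.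
Qed.

(** A separation of the image would make [phi], equal to -1 over [U] and 1 over [V], locally
    constant and thus continuous, contradicting the intermediate value theorem. *)
Lemma connected_lipschitz_image {Y : MetricSpace} (gamma : R -> Y) (K : R) :
  (forall s t, dist (gamma s) (gamma t) <= K * Rabs (s - t)) ->
  connected_set (fun y => exists t, gamma t = y).
Proof.
  intros hK U V hU hV hcov hdis [x [[t0 <-] hx]] [y [[t1 <-] hy]].
  set (phi := fun t => if excluded_middle_informative (U (gamma t)) then -1 else 1).
  assert (hloc : forall W : Y -> Prop, rel_open (fun y => exists t, gamma t = y) W ->
    forall t, W (gamma t) -> exists del, 0 < del /\
      forall s, Rabs (s - t) < del -> W (gamma s)).
  { intros W hW t ht; destruct (hW (gamma t)) as [eps [he hb]]; eauto.
    (* The sign of [K] is not known, so [Rabs K + 1] serves as a positive Lipschitz constant. *)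
    assert (hK1 : 0 < Rabs K + 1) by (pose proof (Rabs_pos K); lra).
    exists (eps / (Rabs K + 1)); split; [apply Rdiv_lt_0_compat; auto |].
    intros s hs; apply hb; eauto.
    eapply Rle_lt_trans; [apply hK |].
    apply Rle_lt_trans with ((Rabs K + 1) * Rabs (s - t)).
    - rewrite Rabs_minus_sym; apply Rmult_le_compat_r; [apply Rabs_pos |].
      pose proof (Rle_abs K); lra.
    - apply (Rmult_lt_compat_l (Rabs K + 1)) in hs; auto.
      replace ((Rabs K + 1) * (eps / (Rabs K + 1))) with eps in hs by (field; lra); lra. }
  assert (hconst : forall t, exists del, 0 < del /\
    forall s, Rabs (s - t) < del -> phi s = phi t).
  { intros t; unfold phi; destruct (excluded_middle_informative (U (gamma t))) as [h|h].
    - destruct (hloc U hU t h) as [del [hd hb]]; exists del; split; auto.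
      intros s hs; destruct excluded_middle_informative; [reflexivity | exfalso; auto].
    - destruct (hcov (gamma t)) as [h'|h']; eauto; [tauto |].
      destruct (hloc V hV t h') as [del [hd hb]]; exists del; split; auto.
      intros s hs; destruct excluded_middle_informative; [exfalso; eauto | reflexivity]. }
  assert (hc : forall t, continuity_pt phi t).
  { intros t eps he; destruct (hconst t) as [del [hd hb]]; exists del; split; auto.
    intros s [_ hs]; simpl in *; unfold Rdist in *; rewrite hb by auto.
    rewrite Rminus_diag, Rabs_R0; auto. }
  assert (hv : forall t, phi t = -1 \/ phi t = 1).
  { intros t; unfold phi; destruct excluded_middle_informative; auto. }
  assert (h0 : phi t0 = -1) by (unfold phi; destruct excluded_middle_informative; tauto).
  assert (h1 : phi t1 = 1).
  { unfold phi; destruct excluded_middle_informative; auto; exfalso; eauto. }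
  assert (hz : exists z, phi z = 0).
  { destruct (Rtotal_order t0 t1) as [h|[h|h]].
    - destruct (IVT_interv phi t0 t1) as [z [_ hz]]; eauto; lra.
    - subst; lra.
    (* The theorem wants the negative value at the left end, hence the change of sign. *)
    - destruct (IVT_interv (- phi)%F t1 t0) as [z [_ hz]].
      + intros; apply continuity_pt_opp; auto.
      + auto.
      + unfold opp_fct; lra.
      + unfold opp_fct; lra.
      + exists z; unfold opp_fct in hz; lra. }
  destruct hz as [z hz]; destruct (hv z); lra.
Qed.

(** * Circles from weighted determinants of plane vectors *)

Section PlanarCircle.

Variables (Y : MetricSpace) (g : R -> R -> Y) (rho : R -> R -> R) (m M : R).
Hypothesis hm : 0 < m.
Hypothesis hrho : forall c s, c <> 0 \/ s <> 0 -> m <= rho c s * norm1 c s <= M.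
Hypothesis hg : forall c s c' s', c <> 0 \/ s <> 0 -> c' <> 0 \/ s' <> 0 ->
  dist (g c s) (g c' s') = rho c s * rho c' s' * Rabs (det c s c' s').

Definition planar_image (y : Y) : Prop := exists c s, (c <> 0 \/ s <> 0) /\ g c s = y.

Lemma rho_pos (c s : R) : c <> 0 \/ s <> 0 -> 0 < rho c s.
Proof.
  intros h; destruct (hrho c s h) as [h1 _]; apply norm1_pos in h.
  destruct (Rlt_dec 0 (rho c s)); [auto |].
  assert (rho c s * norm1 c s <= 0) by nra; lra.
Qed.

Lemma rho_unit (c s : R) : c ^ 2 + s ^ 2 = 1 -> m / 2 <= rho c s <= M.
Proof.
  intros h.
  assert (h0 : c <> 0 \/ s <> 0).
  { destruct (Req_dec c 0) as [->|]; [right | auto]; intros ->; lra. }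
  pose proof (hrho c s h0); pose proof (rho_pos c s h0); pose proof (norm1_unit c s h).
  split; nra.
Qed.

Lemma half_nonzero (p : S1) : half_cos p <> 0 \/ half_sin p <> 0.
Proof.
  destruct (half_angle p) as [h _]; cbv zeta in h.
  destruct (Req_dec (half_cos p) 0) as [e|]; [right | auto].
  intros e'; rewrite e, e' in h; lra.
Qed.

(** On half-angle vectors the weight lies between [m / 2] and [M], and [Rabs det] is half the chord,
    so the parametrization is bi-Lipschitz with constants [m * m / 8] and [M * M / 2]. *)
Lemma planar_homeomorphic : homeomorphic_to_S1 planar_image.
Proof.
  set (f := fun p => g (half_cos p) (half_sin p)).
  set (k := fun p => rho (half_cos p) (half_sin p)).
  assert (hk : forall p, m / 2 <= k p <= M).
  { intros p; apply rho_unit, half_angle. }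
  assert (hd : forall p q, dist (f p) (f q) = k p * k q * S1_dist p q / 2).
  { intros p q; unfold f; rewrite hg by apply half_nonzero.
    rewrite S1_dist_half_angle; unfold k; field. }
  assert (hn : forall p q, 0 <= S1_dist p q) by (intros; apply sqrt_pos).
  assert (hu : forall p q, dist (f p) (f q) <= M * M / 2 * S1_dist p q).
  { intros p q; rewrite hd; pose proof (hk p); pose proof (hk q); pose proof (hn p q).
    assert (k p * k q <= M * M) by (apply Rmult_le_compat; lra).
    assert (0 <= (M * M - k p * k q) * S1_dist p q) by (apply Rmult_le_pos; lra). lra. }
  assert (hl : forall p q, m * m / 8 * S1_dist p q <= dist (f p) (f q)).
  { intros p q; rewrite hd; pose proof (hk p); pose proof (hk q); pose proof (hn p q).
    assert (m / 2 * (m / 2) <= k p * k q) by (apply Rmult_le_compat; lra).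
    assert (0 <= (k p * k q - m / 2 * (m / 2)) * S1_dist p q) by (apply Rmult_le_pos; lra). lra. }
  assert (hM : 0 < M).
  { destruct (hrho 1 0) as [h1 h2]; [left; lra | lra]. }
  assert (hM2 : 0 < M * M / 2) by nra.
  assert (hm2 : 0 < m * m / 8) by nra.
  exists f; repeat split.
  - intros p; exists (half_cos p), (half_sin p); split; [apply half_nonzero | reflexivity].
  - intros y [c [s [h <-]]]; destruct (half_angle_surj c s h) as [p hp]; exists p.
    apply dist_eq0; unfold f; rewrite hg, hp, Rabs_R0 by (auto using half_nonzero); ring.
  - intros p q e.
    assert (h : S1_dist p q = 0).
    { apply Rle_antisym; [| apply hn].
      pose proof (hl p q) as h; rewrite e, dist_self in h; nra. }
    unfold S1_dist in h; apply sqrt_eq_0 in h; [| apply Rplus_le_le_0_compat; apply pow2_ge_0].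
    destruct p as [[x y] hp], q as [[x' y'] hq]; simpl fst in *; simpl snd in *.
    assert (hx := pow2_ge_0 (x - x')); assert (hy := pow2_ge_0 (y - y')).
    assert (ex : x - x' = 0) by (apply Rsqr_0_uniq; unfold Rsqr; lra).
    assert (ey : y - y' = 0) by (apply Rsqr_0_uniq; unfold Rsqr; lra).
    apply Rminus_diag_uniq in ex, ey; subst.
    f_equal; apply proof_irrelevance.
  - intros p eps he; exists (eps / (M * M / 2)); split; [apply Rdiv_lt_0_compat; auto |].
    intros q hq; eapply Rle_lt_trans; [apply hu |].
    apply (Rmult_lt_compat_l (M * M / 2)) in hq; auto.
    replace (M * M / 2 * (eps / (M * M / 2))) with eps in hq by (field; lra); auto.
  - intros p eps he; exists (m * m / 8 * eps); split; [apply Rmult_lt_0_compat; auto |].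
    intros q hq; apply (Rmult_lt_reg_l (m * m / 8)); auto.
    eapply Rle_lt_trans; [apply hl | exact hq].
Qed.

(* [rho c s * norm1 c s <= M], so a path along which [norm1] stays above [delta] has speed at
   most [M ^ 2 / delta ^ 2] times the rate of change of [det]. *)
Lemma planar_segment_connected (xc xs c s c' s' : R) :
  0 < det xc xs c s -> 0 < det xc xs c' s' ->
  connected_set (fun y => exists t, g ((1 - clip t) * c + clip t * c') ((1 - clip t) * s + clip t * s') = y).
Proof.
  intros h h'.
  assert (hx : 0 < norm1 xc xs).
  { apply norm1_pos; destruct (Req_dec xc 0) as [e|]; [right | auto].
    intros e'; unfold det in h; rewrite e, e' in h; lra. }
  (* Along the segment, [det] against [(xc, xs)] is affine and at least its smaller end value;
     [det_le_norm1] turns this into the lower bound [delta] for [norm1]. *)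
  set (delta := Rmin (det xc xs c s) (det xc xs c' s') / norm1 xc xs).
  assert (hdel : 0 < delta).
  { apply Rdiv_lt_0_compat; auto; apply Rmin_glb_lt; auto. }
  set (uc := fun t => (1 - clip t) * c + clip t * c').
  set (us := fun t => (1 - clip t) * s + clip t * s').
  assert (hN : forall t, delta <= norm1 (uc t) (us t)).
  { intros t; pose proof (det_le_norm1 xc xs (uc t) (us t)) as hd.
    assert (e : det xc xs (uc t) (us t) = (1 - clip t) * det xc xs c s + clip t * det xc xs c' s').
    { unfold det, uc, us; ring. }
    pose proof (clip_range t) as hc.
    pose proof (Rmin_l (det xc xs c s) (det xc xs c' s')) as m1.
    pose proof (Rmin_r (det xc xs c s) (det xc xs c' s')) as m2.
    set (mu := Rmin (det xc xs c s) (det xc xs c' s')) in *.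
    assert (mu <= det xc xs (uc t) (us t)) by (rewrite e; nra).
    pose proof (Rle_abs (det xc xs (uc t) (us t))).
    unfold delta; apply (Rmult_le_reg_l (norm1 xc xs)); auto.
    replace (norm1 xc xs * (mu / norm1 xc xs)) with mu by (field; lra); lra. }
  assert (hM : 0 < M).
  { destruct (hrho 1 0) as [h1 h2]; [left; lra | lra]. }
  apply (connected_lipschitz_image (fun t => g (uc t) (us t))
    ((M / delta) * (M / delta) * Rabs (det c s c' s'))).
  assert (hr : forall t, 0 < rho (uc t) (us t) <= M / delta /\ (uc t <> 0 \/ us t <> 0)).
  { intros t; pose proof (hN t) as hn.
    assert (hnz : uc t <> 0 \/ us t <> 0) by (apply norm1_pos; lra).
    pose proof (rho_pos _ _ hnz) as hp; split; [split |]; auto.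
    destruct (hrho _ _ hnz) as [_ hu].
    apply (Rmult_le_reg_l delta); auto.
    replace (delta * (M / delta)) with M by (field; lra).
    apply Rle_trans with (2 := hu); rewrite Rmult_comm; apply Rmult_le_compat_l; lra. }
  intros t1 t2; destruct (hr t1) as [r1 n1], (hr t2) as [r2 n2].
  rewrite hg by auto.
  replace (det (uc t1) (us t1) (uc t2) (us t2)) with ((clip t2 - clip t1) * det c s c' s')
    by (unfold det, uc, us; ring).
  rewrite Rabs_mult, (Rmult_comm (Rabs (clip t2 - clip t1))), <- Rmult_assoc.
  pose proof (clip_lipschitz t2 t1) as hc; rewrite (Rabs_minus_sym t1 t2).
  apply Rmult_le_compat; auto using Rabs_pos.
  - repeat apply Rmult_le_pos; try lra; apply Rabs_pos.
  - apply Rmult_le_compat_r; [apply Rabs_pos | apply Rmult_le_compat; lra].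
Qed.

Lemma planar_neg (c s : R) : c <> 0 \/ s <> 0 -> g (- c) (- s) = g c s.
Proof.
  intros h; apply dist_eq0; rewrite hg.
  - unfold det; replace (- c * s - - s * c) with 0 by ring; rewrite Rabs_R0; ring.
  - destruct h; [left | right]; lra.
  - auto.
Qed.

Lemma planar_det_neq0 (c s c' s' : R) :
  c <> 0 \/ s <> 0 -> c' <> 0 \/ s' <> 0 -> g c s <> g c' s' -> det c s c' s' <> 0.
Proof.
  intros h h' hne e; apply hne, dist_eq0; rewrite hg, e, Rabs_R0 by auto; ring.
Qed.

Lemma planar_neq (c s c' s' : R) :
  c <> 0 \/ s <> 0 -> c' <> 0 \/ s' <> 0 -> det c s c' s' <> 0 -> g c' s' <> g c s.
Proof.
  intros h h' hne e; apply hne.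
  assert (hd := hg c s c' s' h h'); rewrite e, dist_self in hd.
  pose proof (rho_pos c s h) as r; pose proof (rho_pos c' s' h') as r'.
  destruct (Req_dec (det c s c' s') 0) as [|hn]; auto.
  pose proof (Rmult_lt_0_compat _ _ (Rmult_lt_0_compat _ _ r r') (Rabs_pos_lt _ hn)); lra.
Qed.

(** The straight segment between the two vectors stays strictly on one side of both lines, so its
    image avoids the two removed points. *)
Lemma planar_same_side (xc xs zc zs yc ys wc ws : R) :
  xc <> 0 \/ xs <> 0 -> zc <> 0 \/ zs <> 0 ->
  0 < det xc xs yc ys -> 0 < det xc xs wc ws ->
  0 < det zc zs yc ys * det zc zs wc ws ->
  same_component (fun u => planar_image u /\ u <> g xc xs /\ u <> g zc zs) (g yc ys) (g wc ws).
Proof.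
  intros hx hz hy hw hzz.
  exists (fun u => exists t, g ((1 - clip t) * yc + clip t * wc) ((1 - clip t) * ys + clip t * ws) = u).
  split; [| split; [| split]].
  - intros u [t <-]; pose proof (clip_range t) as ht; set (k := clip t) in *.
    set (uc := (1 - k) * yc + k * wc); set (us := (1 - k) * ys + k * ws).
    assert (ex : det xc xs uc us = (1 - k) * det xc xs yc ys + k * det xc xs wc ws)
      by (unfold det, uc, us; ring).
    assert (ez : det zc zs uc us = (1 - k) * det zc zs yc ys + k * det zc zs wc ws)
      by (unfold det, uc, us; ring).
    assert (hux : det xc xs uc us <> 0).
    { rewrite ex; destruct (Req_dec k 0) as [->|]; [lra | nra]. }
    assert (huz : det zc zs uc us <> 0).
    { rewrite ez; set (p := det zc zs yc ys) in *; set (q := det zc zs wc ws) in *; clearbody p q.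
      (* The product equals [(1 - k) * p ^ 2 + k * q ^ 2 + p * q], which is positive because [p * q]
         is. *)
      intros e; assert (e' : ((1 - k) * p + k * q) * (p + q) = 0) by (rewrite e; ring).
      assert (0 <= (1 - k) * (p * p)) by (apply Rmult_le_pos; nra).
      assert (0 <= k * (q * q)) by (apply Rmult_le_pos; nra). lra. }
    assert (hu : uc <> 0 \/ us <> 0).
    { destruct (Req_dec uc 0) as [e|]; [right | auto].
      intros e'; apply hux; unfold det; rewrite e, e'; ring. }
    split; [exists uc, us; auto | split; apply planar_neq; auto].
  - apply planar_segment_connected with xc xs; auto.
  - exists 0; rewrite clip_id by lra; f_equal; ring.
  - exists 1; rewrite clip_id by lra; f_equal; ring.
Qed.

(** If the two terms on the right of the Pluecker relation do not have opposite signs, their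
    absolute values add up. If they do, suitable representatives of [y] and [w] are on the same side
    of the lines of [x] and [z], so the points are not separated. *)
Lemma planar_circle : is_circle planar_image.
Proof.
  split; [apply planar_homeomorphic |].
  intros ? ? ? ? [xc [xs [hx <-]]] [yc [ys [hy <-]]] [zc [zs [hz <-]]] [wc [ws [hw <-]]].
  intros xy xz xw yz yw zw hsep.
  rewrite !hg by auto.
  pose proof (planar_det_neq0 _ _ _ _ hx hy xy) as dxy.
  pose proof (planar_det_neq0 _ _ _ _ hx hw xw) as dxw.
  assert (key : Rabs (det xc xs zc zs) * Rabs (det yc ys wc ws) =
    Rabs (det xc xs yc ys) * Rabs (det zc zs wc ws) +
    Rabs (det xc xs wc ws) * Rabs (det yc ys zc zs)).
  { assert (pluecker : det xc xs zc zs * det yc ys wc ws =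
      det xc xs yc ys * det zc zs wc ws + det xc xs wc ws * det yc ys zc zs)
      by (unfold det; ring).
    destruct (Rle_dec 0 (det xc xs yc ys * det zc zs wc ws * (det xc xs wc ws * det yc ys zc zs)))
      as [h|h].
    - rewrite <- !Rabs_mult, pluecker.
      set (p := det xc xs yc ys * det zc zs wc ws) in *.
      set (q := det xc xs wc ws * det yc ys zc zs) in *; clearbody p q.
      unfold Rabs; repeat destruct Rcase_abs; nra.
    - exfalso; apply hsep; apply Rnot_le_lt in h.
      (* A vector and its negative give the same point, so both representatives can be put on the
         positive side of the line of [x]. *)
      assert (flip : forall c s, exists c' s', g c s = g c' s' /\
        (det xc xs c s <> 0 -> 0 < det xc xs c' s') /\
        ((c' = c /\ s' = s /\ 0 <= det xc xs c s) \/
         (c' = - c /\ s' = - s /\ det xc xs c s <= 0))).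
      { intros c s; destruct (Rle_dec 0 (det xc xs c s)) as [hd|hd].
        - exists c, s; repeat split; auto; lra.
        - exists (- c), (- s); repeat split.
          + symmetry; apply planar_neg.
            destruct (Req_dec c 0) as [e|]; [right | auto].
            intros e'; apply hd; unfold det; rewrite e, e'; lra.
          + unfold det in *; lra.
          + right; lra. }
      destruct (flip yc ys) as [yc' [ys' [ey [py cy]]]].
      destruct (flip wc ws) as [wc' [ws' [ew [pw cw]]]].
      rewrite ey, ew; apply planar_same_side; auto.
      set (A := det xc xs yc ys) in *; set (B := det xc xs wc ws) in *.
      assert (e1 : 0 < A * B * (det zc zs yc ys * det zc zs wc ws)).
      { replace (det yc ys zc zs) with (- det zc zs yc ys) in h by (unfold det; ring); lra. }
      set (C := det zc zs yc ys) in *; set (E := det zc zs wc ws) in *.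
      assert (nC : det zc zs (- yc) (- ys) = - C) by (unfold C, det; ring).
      assert (nE : det zc zs (- wc) (- ws) = - E) by (unfold E, det; ring).
      destruct cy as [[-> [-> sA]]|[-> [-> sA]]], cw as [[-> [-> sB]]|[-> [-> sB]]];
        rewrite ?nC, ?nE; fold C E.
      + apply (pos_factor (A * B)); [apply Rmult_le_pos; lra | lra].
      + apply (pos_factor (A * - B)); [apply Rmult_le_pos; lra | lra].
      + apply (pos_factor (- A * B)); [apply Rmult_le_pos; lra | lra].
      + apply (pos_factor (- A * - B)); [apply Rmult_le_pos; lra | lra]. }
  set (X := rho xc xs); set (Y' := rho yc ys); set (Z := rho zc zs); set (W := rho wc ws).
  transitivity (X * Y' * Z * W * (Rabs (det xc xs zc zs) * Rabs (det yc ys wc ws))); [ring |].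
  rewrite key; ring.
Qed.

End PlanarCircle.

(** * Iterated addition of segments *)

(* The label [n] of [Seg n a b t] only raises its level, so that the segment from [a] to [b] can be
   added anew after any given stage. *)
Inductive tree (X : Type) : Type :=
| Leaf (x : X)
| Seg (n : nat) (a b : tree X) (t : R).
Arguments Leaf {X}. Arguments Seg {X}.

Section Tower.

Variable X : MetricSpace.
Hypothesis hX : Ptolemy X.

Fixpoint level (a : tree X) : nat :=
  match a with
  | Leaf _ => 0
  | Seg n a b _ => S (Nat.max n (Nat.max (level a) (level b)))
  end.

Fixpoint base (a : tree X) : X :=
  match a with
  | Leaf x => x
  | Seg _ a _ _ => base a
  end.

(* [None] is the point at infinity; the values on trees that are not leaves do not affect [tdist]. *)
Definition dist0 (p q : option (tree X)) : R :=
  match p, q with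
  | Some a, Some b => dist (base a) (base b)
  | None, None => 0
  | _, _ => 1
  end.

(* Stage [n + 1] adds exactly the segments of level [n + 1]; all other trees count as points. *)
Definition view (n : nat) (p : option (tree X)) : segpt (option (tree X)) :=
  match p with
  | Some (Seg k a b t) =>
      if Nat.eq_dec (level (Seg k a b t)) (S n) then SegPt (Some a) (Some b) (clip t) else pure p
  | _ => pure p
  end.

Fixpoint distn (n : nat) : option (tree X) -> option (tree X) -> R :=
  match n with
  | O => dist0
  | S n => fun p q => segdist (distn n) (view n p) (view n q)
  end.

Lemma on_seg_view (n : nat) (p : option (tree X)) : on_seg (view n p).
Proof.
  destruct p as [[x|k a b t]|]; simpl; try apply on_seg_pure.
  destruct Nat.eq_dec; [apply clip_range | apply on_seg_pure].
Qed.

Lemma view_low (n : nat) (a : tree X) : (level a <= n)%nat -> view n (Some a) = pure (Some a).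
Proof.
  destruct a as [x|k a b t]; intros h; [reflexivity |].
  unfold view; destruct Nat.eq_dec; [lia | reflexivity].
Qed.

(** With both ends of level at most [n], the label [n] forces the level to be exactly [n + 1], so
    the segment is fresh at the next stage. *)
Lemma view_new (n : nat) (a b : tree X) (t : R) :
  (level a <= n)%nat -> (level b <= n)%nat -> 0 <= t <= 1 ->
  view n (Some (Seg n a b t)) = SegPt (Some a) (Some b) t.
Proof.
  intros ha hb ht; unfold view; destruct Nat.eq_dec as [|h].
  - rewrite clip_id by auto; reflexivity.
  - exfalso; apply h; simpl; lia.
Qed.

(** With exactly one point at infinity the inequalities are the triangle inequality of [X]; with
    more, they follow from nonnegativity. *)
Lemma ptolemaic_dist0 : ptolemaic dist0.
Proof.
  split.
  - intros [a|] [b|]; simpl; try lra; apply dist_nonneg.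
  - intros [a|]; simpl; [apply dist_self | reflexivity].
  - intros [a|] [b|]; simpl; auto; apply dist_sym.
  - assert (tri : forall x y z : tree X,
      dist (base x) (base y) <= dist (base x) (base z) + dist (base y) (base z)).
    { intros x y z; rewrite (dist_sym _ (base y)); apply dist_triangle. }
    assert (tri3 : forall x y z : tree X,
      dist (base x) (base y) <= dist (base x) (base z) + dist (base y) (base z) /\
      dist (base x) (base z) <= dist (base x) (base y) + dist (base y) (base z) /\
      dist (base y) (base z) <= dist (base x) (base y) + dist (base x) (base z)).
    { intros x y z; pose proof (tri x y z); pose proof (tri x z y); pose proof (tri y z x).
      pose proof (dist_sym _ (base x) (base y)); pose proof (dist_sym _ (base x) (base z)).
      pose proof (dist_sym _ (base y) (base z)); lra. }
    assert (nn : forall x y : tree X, 0 <= dist (base x) (base y)).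
    { intros; apply dist_nonneg. }
    intros [a|] [b|] [c|] [e|]; unfold ptolemy4; simpl.
    1: { pose proof (hX (base a) (base b) (base c) (base e)) as h1.
         pose proof (hX (base a) (base c) (base b) (base e)) as h2.
         pose proof (hX (base a) (base e) (base b) (base c)) as h3.
         rewrite (dist_sym _ (base c) (base b)) in h2.
         rewrite (dist_sym _ (base e) (base c)), (dist_sym _ (base e) (base b)) in h3.
         lra. }
    (* The four goals selected here have exactly one point at infinity. *)
    1: pose proof (tri3 a b c); lra.
    1: pose proof (tri3 a b e); lra.
    2: pose proof (tri3 a c e); lra.
    5: pose proof (tri3 b c e); lra.
    all: repeat match goal with u : tree X, v : tree X |- _ =>
           lazymatch goal with _ : 0 <= dist (base u) (base v) |- _ => fail
           | _ => pose proof (nn u v) end end; lra.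
Qed.

Lemma ptolemaic_distn (n : nat) : ptolemaic (distn n).
Proof.
  induction n as [|n IH]; [apply ptolemaic_dist0 |].
  exact (ptolemaic_segdist (distn n) (view n) IH (on_seg_view n)).
Qed.

(** Infinity is an old point at every stage, and an affine combination of 1 and 1 is again 1. *)
Lemma distn_infinity (n : nat) (a : tree X) : distn n (Some a) None = 1.
Proof.
  revert a; induction n as [|n IH]; intros a; [reflexivity |].
  cbn [distn]; change (view n None) with (pure (@None (tree X))).
  rewrite (segdist_pure_r _ _ (ptolemaic_distn n)).
  destruct a as [x|k a b t]; unfold view; [simpl; rewrite IH; ring |].
  destruct Nat.eq_dec; simpl; rewrite ?IH; ring.
Qed.

Lemma distn_stable (n : nat) (a b : tree X) :
  (level a <= n)%nat -> (level b <= n)%nat ->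
  distn (S n) (Some a) (Some b) = distn n (Some a) (Some b).
Proof.
  intros ha hb; cbn [distn]; rewrite !view_low by auto.
  apply segdist_pure, ptolemaic_distn.
Qed.

Definition tdist (a b : tree X) : R := distn (Nat.max (level a) (level b)) (Some a) (Some b).

(** Values no longer change once both levels are reached, so any finite set of trees can be compared
    at one common stage. *)
Lemma tdist_distn (n : nat) (a b : tree X) :
  (level a <= n)%nat -> (level b <= n)%nat -> tdist a b = distn n (Some a) (Some b).
Proof.
  intros ha hb; unfold tdist.
  set (m := Nat.max (level a) (level b)).
  assert (hm : (m <= n)%nat) by (unfold m; lia).
  induction hm as [|n hm IH]; [reflexivity |].
  rewrite distn_stable by (unfold m in *; lia); apply IH; unfold m in *; lia.
Qed.

Lemma ptolemaic_tdist : ptolemaic tdist.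
Proof.
  split.
  - intros a b; apply (pt_nonneg _ (ptolemaic_distn _)).
  - intros a; apply (pt_self _ (ptolemaic_distn _)).
  - intros a b; unfold tdist; rewrite Nat.max_comm; apply (pt_sym _ (ptolemaic_distn _)).
  - intros a b c e.
    set (n := (level a + level b + level c + level e)%nat).
    pose proof (pt_ineq _ (ptolemaic_distn n) (Some a) (Some b) (Some c) (Some e)) as h.
    unfold ptolemy4 in *; rewrite !(tdist_distn n) by lia; exact h.
Qed.

(* The Ptolemy inequality with the fourth point at infinity. *)
Lemma tdist_triangle (a b c : tree X) : tdist a c <= tdist a b + tdist b c.
Proof.
  set (n := (level a + level b + level c)%nat).
  destruct (pt_ineq _ (ptolemaic_distn n) (Some a) (Some c) (Some b) None) as [h _].
  rewrite !distn_infinity, !(pt_sym _ (ptolemaic_distn n) (Some c) (Some b)) in h.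
  rewrite !(tdist_distn n) by lia; lra.
Qed.

Lemma tdist_leaf (x y : X) : tdist (Leaf x) (Leaf y) = dist x y.
Proof. reflexivity. Qed.

(** Equal labels, at least all the end levels, make both segments appear at the same stage. *)
Lemma tdist_new (n : nat) (a b c e : tree X) (s t : R) :
  (level a <= n)%nat -> (level b <= n)%nat -> (level c <= n)%nat -> (level e <= n)%nat ->
  0 <= s <= 1 -> 0 <= t <= 1 ->
  tdist (Seg n a b s) (Seg n c e t) =
  segdist (distn n) (SegPt (Some a) (Some b) s) (SegPt (Some c) (Some e) t).
Proof.
  intros; rewrite (tdist_distn (S n)) by (simpl; lia).
  cbn [distn]; rewrite !view_new by auto; reflexivity.
Qed.

Lemma tdist_new_same (n : nat) (a b : tree X) (s t : R) :
  (level a <= n)%nat -> (level b <= n)%nat -> 0 <= s <= 1 -> 0 <= t <= 1 ->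
  tdist (Seg n a b s) (Seg n a b t) = Rabs (s - t) * tdist a b.
Proof.
  intros; rewrite tdist_new by auto; rewrite segdist_same by (split; reflexivity).
  simpl; rewrite (tdist_distn n) by auto; reflexivity.
Qed.

Lemma tdist_new_other (n : nat) (a b c e : tree X) (s t : R) :
  (level a <= n)%nat -> (level b <= n)%nat -> (level c <= n)%nat -> (level e <= n)%nat ->
  0 <= s <= 1 -> 0 <= t <= 1 -> a <> c \/ b <> e ->
  tdist (Seg n a b s) (Seg n c e t) =
  (1 - s) * ((1 - t) * tdist a c + t * tdist a e) + s * ((1 - t) * tdist b c + t * tdist b e).
Proof.
  intros; rewrite tdist_new by auto; rewrite segdist_other.
  - unfold bilin; simpl; rewrite !(tdist_distn n) by auto; reflexivity.
  - intros [h1 h2]; simpl in *; injection h1; injection h2; tauto.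
Qed.

Lemma tdist_old_new (n : nat) (a b c : tree X) (s : R) :
  (level a <= n)%nat -> (level b <= n)%nat -> (level c <= n)%nat -> 0 <= s <= 1 ->
  tdist (Seg n a b s) c = (1 - s) * tdist a c + s * tdist b c.
Proof.
  intros; rewrite (tdist_distn (S n)) by (simpl; lia).
  cbn [distn]; rewrite view_new, view_low by auto.
  rewrite (segdist_pure_r _ _ (ptolemaic_distn n)); simpl.
  rewrite !(tdist_distn n) by auto; reflexivity.
Qed.

End Tower.

(** * Identification of points at distance 0 *)

Section Quotient.

Variables (T : Type) (d : T -> T -> R).
Hypothesis hd : ptolemaic d.
Hypothesis triangle : forall a b c, d a c <= d a b + d b c.

Definition zero_class (a : T) : T -> Prop := fun b => d a b = 0.

Definition quotient_type : Type := {P : T -> Prop | exists a, P = zero_class a}.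

Definition proj (a : T) : quotient_type := exist _ (zero_class a) (ex_intro _ a eq_refl).

Definition repr (y : quotient_type) : T :=
  proj1_sig (constructive_indefinite_description _ (proj2_sig y)).

Lemma proj_repr (y : quotient_type) : proj (repr y) = y.
Proof.
  unfold repr; destruct constructive_indefinite_description as [a ha]; simpl.
  destruct y as [P hP]; simpl in ha; subst P; unfold proj; f_equal; apply proof_irrelevance.
Qed.

Lemma zero_dist_repr (a : T) : d (repr (proj a)) a = 0.
Proof.
  (* Two equal classes are evaluated at [a]: the claim is the same proposition as [d a a = 0]. *)
  pose proof (f_equal (fun y : quotient_type => proj1_sig y a) (proj_repr (proj a))) as h.
  simpl in h; unfold zero_class in h; rewrite h; apply (pt_self d hd).
Qed.

Lemma dist_zero_l (a a' b : T) : d a a' = 0 -> d a b = d a' b.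
Proof.
  intros h; pose proof (triangle a a' b); pose proof (triangle a' a b).
  rewrite (pt_sym d hd a' a) in *; lra.
Qed.

Lemma dist_repr_proj (a b : T) : d (repr (proj a)) (repr (proj b)) = d a b.
Proof.
  rewrite (dist_zero_l _ a) by apply zero_dist_repr.
  rewrite !(pt_sym d hd a); apply dist_zero_l, zero_dist_repr.
Qed.

Lemma proj_eq (a b : T) : d a b = 0 -> proj a = proj b.
Proof.
  intros h; assert (e : zero_class a = zero_class b).
  (* The distances from [a] and from [b] to [c] are equal reals, so rewriting makes the two
     propositions identical. *)
  { apply functional_extensionality; intros c; unfold zero_class.
    rewrite (dist_zero_l a b c h); reflexivity. }
  apply eq_sig_hprop; [intros; apply proof_irrelevance | exact e].
Qed.

Lemma metric_quotient :
  exists (Y : MetricSpace) (p : T -> Y),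
    (forall y, exists a, p a = y) /\ forall a b, dist (p a) (p b) = d a b.
Proof.
  unshelve eexists {| carrier := quotient_type; dist := fun x y => d (repr x) (repr y) |}.
  - intros; apply (pt_nonneg d hd).
  - intros; apply (pt_self d hd).
  - intros x y h; rewrite <- (proj_repr x), <- (proj_repr y); apply proj_eq, h.
  - intros; apply (pt_sym d hd).
  - intros; apply triangle.
  - exists proj; split.
    + intros y; exists (repr y); apply proj_repr.
    + apply dist_repr_proj.
Qed.

End Quotient.

(** * Triangles of segments are circles *)

(* The position on an edge of the point with weights [w] and [x] at its two ends. *)
Definition mix (w x : R) : R := x / (w + x).

Lemma mix_range (w x : R) : 0 <= w -> 0 <= x -> 0 < w + x -> 0 <= mix w x <= 1.
Proof.
  intros hw hx h; unfold mix; split.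
  - apply Rle_mult_inv_pos; auto.
  - apply (Rmult_le_reg_r (w + x)); auto; unfold Rdiv.
    rewrite Rmult_assoc, Rinv_l by lra; lra.
Qed.

(** Clearing denominators leaves an expression homogeneous in the weights; the factors [/ (w + x)]
    become the function [rho] of the circle. *)
Lemma mix_same (w x w' x' : R) :
  0 < w + x -> 0 < w' + x' ->
  Rabs (mix w x - mix w' x') = / (w + x) * / (w' + x') * Rabs (w * x' - x * w').
Proof.
  intros h h'.
  assert (k : 0 < / (w + x) * / (w' + x'))
    by (apply Rmult_lt_0_compat; apply Rinv_0_lt_compat; auto).
  rewrite <- (Rabs_right (/ (w + x) * / (w' + x'))) by lra.
  rewrite <- Rabs_mult, Rabs_minus_sym; f_equal; unfold mix; field; lra.
Qed.

Lemma mix_other (w x w' x' p q r t : R) :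
  0 < w + x -> 0 < w' + x' ->
  (1 - mix w x) * ((1 - mix w' x') * p + mix w' x' * q) +
    mix w x * ((1 - mix w' x') * r + mix w' x' * t) =
  / (w + x) * / (w' + x') * (w * w' * p + w * x' * q + x * w' * r + x * x' * t).
Proof.
  intros h h'; unfold mix; field; lra.
Qed.

Section Triangle.

Variables (Y : MetricSpace) (e01 e12 e02 : R -> Y) (l0 l1 l2 : R).
Hypotheses (h0 : 0 < l0) (h1 : 0 < l1) (h2 : 0 < l2).

Definition affine_pair (e e' : R -> Y) (p q r t : R) : Prop :=
  forall u v, 0 <= u <= 1 -> 0 <= v <= 1 ->
    dist (e u) (e' v) = (1 - u) * ((1 - v) * p + v * q) + u * ((1 - v) * r + v * t).

Definition geodesic_edge (e : R -> Y) (l : R) : Prop :=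
  forall u v, 0 <= u <= 1 -> 0 <= v <= 1 -> dist (e u) (e v) = Rabs (u - v) * l.

Hypotheses
  (g01 : geodesic_edge e01 (l0 * l1))
  (g12 : geodesic_edge e12 (l1 * l2))
  (g02 : geodesic_edge e02 (l0 * l2))
  (a0112 : affine_pair e01 e12 (l0 * l1) (l0 * l2) 0 (l1 * l2))
  (a0102 : affine_pair e01 e02 0 (l0 * l2) (l0 * l1) (l1 * l2))
  (a1202 : affine_pair e12 e02 (l0 * l1) (l1 * l2) (l0 * l2) 0).

(* The vertices sit at the directions (l0, 0), (0, l1) and l2 (1, -1), whose pairwise
   determinants are the side lengths up to sign. The three cases are the sectors of the half plane
   [0 <= c] cut out by the lines in these directions. *)
Definition half_weight (c s : R) : R :=
  if Rle_dec 0 s then c / l0 + s / l1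
  else if Rle_dec c (- s) then (- s - c) / l1 + c / l2
  else (c + s) / l0 + - s / l2.

(** The weights are the coordinates of [(c, s)] in the vertex directions bounding its sector, with
    (0, -l1) for (0, l1) in the second case. *)
Definition half_point (c s : R) : Y :=
  if Rle_dec 0 s then e01 (mix (c / l0) (s / l1))
  else if Rle_dec c (- s) then e12 (mix ((- s - c) / l1) (c / l2))
  else e02 (mix ((c + s) / l0) (- s / l2)).

Lemma div_nonneg (x l : R) : 0 < l -> 0 <= x -> 0 <= x / l.
Proof. intros; apply Rle_mult_inv_pos; auto. Qed.

Lemma div_sum_pos (x l y k : R) :
  0 < l -> 0 < k -> 0 <= x -> 0 <= y -> 0 < x + y -> 0 < x / l + y / k.
Proof.
  intros hl hk hx hy hxy; pose proof (div_nonneg x l hl hx); pose proof (div_nonneg y k hk hy).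
  destruct (Req_dec x 0) as [->|].
  - assert (0 < y / k) by (apply Rdiv_lt_0_compat; lra); lra.
  - assert (0 < x / l) by (apply Rdiv_lt_0_compat; lra); lra.
Qed.

(** Within a sector, [det] is the determinant of the weights times the side length, up to sign. On
    two different sectors [det] does not change sign, so its absolute value is bilinear in the
    weights and matches the affine distance formula. *)
Lemma half_dist (c s c' s' : R) :
  0 <= c -> c <> 0 \/ s <> 0 -> 0 <= c' -> c' <> 0 \/ s' <> 0 ->
  dist (half_point c s) (half_point c' s') =
  / half_weight c s * / half_weight c' s' * Rabs (det c s c' s').
Proof.
  assert (same : forall e l k w x w' x' D, 0 < l -> 0 < k -> geodesic_edge e (l * k) ->
    0 <= w -> 0 <= x -> 0 < w + x -> 0 <= w' -> 0 <= x' -> 0 < w' + x' ->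
    Rabs (w * x' - x * w') = Rabs D ->
    dist (e (mix (w / l) (x / k))) (e (mix (w' / l) (x' / k))) =
    / (w / l + x / k) * / (w' / l + x' / k) * Rabs D).
  { intros e l k w x w' x' D hl hk he hw hx hwx hw' hx' hwx' hD.
    rewrite he by (apply mix_range; auto using div_nonneg, div_sum_pos).
    rewrite mix_same by (apply div_sum_pos; auto).
    rewrite <- hD, !Rmult_assoc; do 2 f_equal.
    rewrite <- (Rabs_right (l * k)) by (apply Rle_ge, Rmult_le_pos; lra).
    rewrite <- Rabs_mult; f_equal; field; lra. }
  assert (other : forall e e' l k l' k' w x w' x' p q r t D,
    0 < l -> 0 < k -> 0 < l' -> 0 < k' -> affine_pair e e' p q r t ->
    0 <= w -> 0 <= x -> 0 < w + x -> 0 <= w' -> 0 <= x' -> 0 < w' + x' ->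
    w / l * (w' / l') * p + w / l * (x' / k') * q +
      x / k * (w' / l') * r + x / k * (x' / k') * t = Rabs D ->
    dist (e (mix (w / l) (x / k))) (e' (mix (w' / l') (x' / k'))) =
    / (w / l + x / k) * / (w' / l' + x' / k') * Rabs D).
  { intros e e' l k l' k' w x w' x' p q r t D hl hk hl' hk' he hw hx hwx hw' hx' hwx' hD.
    rewrite he by (apply mix_range; auto using div_nonneg, div_sum_pos).
    rewrite mix_other by (apply div_sum_pos; auto).
    rewrite hD; reflexivity. }
  assert (nz : forall c s, 0 <= c -> 0 <= s -> c <> 0 \/ s <> 0 -> 0 < c + s).
  { intros x y hx hy [h|h]; lra. }
  assert (hAB : forall c s c' s', 0 <= c -> 0 <= s -> c <> 0 \/ s <> 0 ->
    0 <= c' -> ~ 0 <= s' -> c' <= - s' ->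
    dist (e01 (mix (c / l0) (s / l1))) (e12 (mix ((- s' - c') / l1) (c' / l2))) =
    / (c / l0 + s / l1) * / ((- s' - c') / l1 + c' / l2) * Rabs (det c s c' s')).
  { intros u v u' v' hu hv huv hu' hv' huv'.
    apply (other _ _ _ _ _ _ _ _ _ _ _ _ _ _ _ h0 h1 h1 h2 a0112); auto; try lra.
    unfold det; rewrite Rabs_left1 by nra; field; lra. }
  assert (hAC : forall c s c' s', 0 <= c -> 0 <= s -> c <> 0 \/ s <> 0 ->
    0 <= c' -> ~ 0 <= s' -> ~ c' <= - s' ->
    dist (e01 (mix (c / l0) (s / l1))) (e02 (mix ((c' + s') / l0) (- s' / l2))) =
    / (c / l0 + s / l1) * / ((c' + s') / l0 + - s' / l2) * Rabs (det c s c' s')).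
  { intros u v u' v' hu hv huv hu' hv' huv'.
    apply (other _ _ _ _ _ _ _ _ _ _ _ _ _ _ _ h0 h1 h0 h2 a0102); auto; try lra.
    unfold det; rewrite Rabs_left1 by nra; field; lra. }
  assert (hBC : forall c s c' s', 0 <= c -> ~ 0 <= s -> c <= - s ->
    0 <= c' -> ~ 0 <= s' -> ~ c' <= - s' ->
    dist (e12 (mix ((- s - c) / l1) (c / l2))) (e02 (mix ((c' + s') / l0) (- s' / l2))) =
    / ((- s - c) / l1 + c / l2) * / ((c' + s') / l0 + - s' / l2) * Rabs (det c s c' s')).
  { intros u v u' v' hu hv huv hu' hv' huv'.
    apply (other _ _ _ _ _ _ _ _ _ _ _ _ _ _ _ h1 h2 h0 h2 a1202); auto; try lra.
    unfold det; rewrite Rabs_right by nra; field; lra. }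
  assert (flip : forall u v u' v', Rabs (det u v u' v') = Rabs (det u' v' u v)).
  { intros; rewrite <- Rabs_Ropp; f_equal; unfold det; ring. }
  intros hc hn hc' hn'; unfold half_point, half_weight.
  destruct (Rle_dec 0 s); [| destruct (Rle_dec c (- s))];
    (destruct (Rle_dec 0 s'); [| destruct (Rle_dec c' (- s'))]).
  - apply same; auto; f_equal; unfold det; ring.
  - apply hAB; auto.
  - apply hAC; auto.
  - rewrite dist_sym, flip, (Rmult_comm (/ _) (/ _)); apply hAB; auto.
  - apply same; auto; try lra; f_equal; unfold det; ring.
  - apply hBC; auto.
  - rewrite dist_sym, flip, (Rmult_comm (/ _) (/ _)); apply hAC; auto.
  - rewrite dist_sym, flip, (Rmult_comm (/ _) (/ _)); apply hBC; auto.
  - apply same; auto; try lra; rewrite <- Rabs_Ropp; f_equal; unfold det; ring.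
Qed.

(** The numerators of the weights add up to [norm1] in the first sector and to the larger of the
    absolute values of [c] and [s] in the others, so they determine [norm1] up to a factor 2. *)
Lemma half_weight_bounds :
  exists m M, 0 < m /\ forall c s, 0 <= c -> c <> 0 \/ s <> 0 ->
    m <= / half_weight c s * norm1 c s <= M.
Proof.
  set (m := Rmin l0 (Rmin l1 l2)).
  assert (hm : 0 < m) by (repeat apply Rmin_glb_lt; auto).
  assert (m0 : m <= l0) by apply Rmin_l.
  assert (m1 : m <= l1) by (eapply Rle_trans; [apply Rmin_r | apply Rmin_l]).
  assert (m2 : m <= l2) by (eapply Rle_trans; [apply Rmin_r | apply Rmin_r]).
  exists m, (2 * (l0 + l1 + l2)); split; auto.
  intros c s hc hn.
  assert (bound : forall x l y k N, m <= l -> m <= k -> l + k <= l0 + l1 + l2 ->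
    0 <= x -> 0 <= y -> 0 < x + y -> x + y <= N <= 2 * (x + y) ->
    m <= / (x / l + y / k) * N <= 2 * (l0 + l1 + l2)).
  { intros x l y k N hl hk hlk hx hy hxy hN.
    pose proof (div_sum_pos x l y k ltac:(lra) ltac:(lra) hx hy hxy) as hW.
    pose proof (div_nonneg x l ltac:(lra) hx) as p; pose proof (div_nonneg y k ltac:(lra) hy) as q.
    assert (ex : x = l * (x / l)) by (field; lra); assert (ey : y = k * (y / k)) by (field; lra).
    set (p' := x / l) in *; set (q' := y / k) in *.
    split; apply (Rmult_le_reg_l (p' + q')); auto;
      rewrite <- ?Rmult_assoc, Rinv_r by lra; rewrite Rmult_1_l.
    - apply Rle_trans with (x + y); [rewrite ex, ey; nra | lra].
    - apply Rle_trans with (2 * (x + y)); [lra | rewrite ex, ey].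
      assert (0 <= (l0 + l1 + l2 - l) * p') by (apply Rmult_le_pos; lra).
      assert (0 <= (l0 + l1 + l2 - k) * q') by (apply Rmult_le_pos; lra). lra. }
  unfold half_weight, norm1; rewrite (Rabs_right c) by lra.
  destruct (Rle_dec 0 s); [| destruct (Rle_dec c (- s))].
  - rewrite Rabs_right by lra; assert (0 < c + s) by (destruct hn; lra); apply bound; lra.
  - rewrite Rabs_left by lra; apply bound; lra.
  - rewrite Rabs_left by lra; apply bound; lra.
Qed.

Lemma triangle_circle :
  exists sigma : Y -> Prop,
    is_circle sigma /\ sigma (e01 0) /\ sigma (e01 1) /\ sigma (e12 1).
Proof.
  (* Vectors with [c < 0] are replaced by their negatives. On the axis [c = 0] opposite vectors both
     belong to the half plane, and [half_dist] puts their points at distance 0. *)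
  set (g := fun c s => if Rle_dec 0 c then half_point c s else half_point (- c) (- s)).
  set (rho := fun c s =>
    if Rle_dec 0 c then / half_weight c s else / half_weight (- c) (- s)).
  assert (nz : forall c s, c <> 0 \/ s <> 0 -> - c <> 0 \/ - s <> 0).
  { intros c s [h|h]; [left | right]; lra. }
  destruct half_weight_bounds as [m [M [hm hb]]].
  exists (planar_image Y g); split; [| repeat split].
  - apply planar_circle with rho m M; auto.
    + intros c s h; unfold rho; destruct (Rle_dec 0 c); [apply hb; auto |].
      replace (norm1 c s) with (norm1 (- c) (- s)) by (unfold norm1; rewrite !Rabs_Ropp; auto).
      apply hb; auto; lra.
    + intros c s c' s' h h'; unfold rho, g.
      destruct (Rle_dec 0 c), (Rle_dec 0 c'); rewrite half_dist by (auto; lra); f_equal.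
      * rewrite <- Rabs_Ropp; f_equal; unfold det; ring.
      * rewrite <- Rabs_Ropp; f_equal; unfold det; ring.
      * f_equal; unfold det; ring.
  (* The vertices have directions (1, 0), (0, 1) and (1, -1); the last lies on the common boundary
     of two sectors and is read on [e12]. *)
  - exists 1, 0; split; [left; lra |].
    unfold g, half_point; destruct Rle_dec; [| lra]; destruct Rle_dec; [| lra].
    f_equal; unfold mix; field; lra.
  - exists 0, 1; split; [right; lra |].
    unfold g, half_point; destruct Rle_dec; [| lra]; destruct Rle_dec; [| lra].
    f_equal; unfold mix; field; lra.
  - exists 1, (-1); split; [left; lra |].
    unfold g, half_point; destruct Rle_dec; [| lra]; destruct Rle_dec; [lra |].
    destruct Rle_dec; [| lra].
    f_equal; unfold mix; field; lra.
Qed.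

End Triangle.

(** Multiplying the three equations shows that [k] must be [l0 * l1 * l2], and each scale is [k]
    divided by the opposite side. *)
Lemma triangle_scales (d01 d12 d02 : R) :
  0 < d01 -> 0 < d12 -> 0 < d02 ->
  exists l0 l1 l2, 0 < l0 /\ 0 < l1 /\ 0 < l2 /\
    l0 * l1 = d01 /\ l1 * l2 = d12 /\ l0 * l2 = d02.
Proof.
  intros p q r.
  set (k := sqrt (d01 * d12 * d02)).
  assert (hk : 0 < k) by (apply sqrt_lt_R0; repeat apply Rmult_lt_0_compat; auto).
  assert (hkk : k * k = d01 * d12 * d02).
  { apply sqrt_sqrt; apply Rlt_le; repeat apply Rmult_lt_0_compat; auto. }
  exists (k / d12), (k / d02), (k / d01); repeat split;
    try (apply Rdiv_lt_0_compat; auto).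
  - replace (k / d12 * (k / d02)) with (k * k / (d12 * d02)) by (field; lra).
    rewrite hkk; field; lra.
  - replace (k / d02 * (k / d01)) with (k * k / (d02 * d01)) by (field; lra).
    rewrite hkk; field; lra.
  - replace (k / d12 * (k / d01)) with (k * k / (d12 * d01)) by (field; lra).
    rewrite hkk; field; lra.
Qed.

(** A label [n] above the three levels makes all three edges fresh at once, so that even points
    which were already joined get edges obeying the affine distance formulas. *)
Lemma tree_triangle_circle (X Y : MetricSpace) (p : tree X -> Y) (a b c : tree X) :
  Ptolemy X -> (forall u v, dist (p u) (p v) = tdist X u v) ->
  p a <> p b -> p b <> p c -> p a <> p c ->
  exists sigma : Y -> Prop, is_circle sigma /\ sigma (p a) /\ sigma (p b) /\ sigma (p c).
Proof.
  intros hX hp ab bc ac.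
  assert (pos : forall u v, p u <> p v -> 0 < tdist X u v).
  { intros u v h; rewrite <- hp; destruct (dist_nonneg _ (p u) (p v)) as [|e]; auto.
    exfalso; apply h, dist_eq0; auto. }
  destruct (triangle_scales _ _ _ (pos a b ab) (pos b c bc) (pos a c ac))
    as [l0 [l1 [l2 [h0 [h1 [h2 [e01 [e12 e02]]]]]]]].
  set (n := (level X a + level X b + level X c)%nat).
  assert (la : (level X a <= n)%nat) by lia.
  assert (lb : (level X b <= n)%nat) by lia.
  assert (lc : (level X c <= n)%nat) by lia.
  assert (nab : a <> b) by congruence.
  assert (nbc : b <> c) by congruence.
  assert (nac : a <> c) by congruence.
  pose proof (pt_self _ (ptolemaic_tdist X hX)) as self.
  pose proof (pt_sym _ (ptolemaic_tdist X hX)) as sym.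
  destruct (triangle_circle Y (fun t => p (Seg n a b t)) (fun t => p (Seg n b c t))
    (fun t => p (Seg n a c t)) l0 l1 l2 h0 h1 h2) as [sigma [hs [sa [sb sc]]]].
  1-3: intros u v hu hv; rewrite hp, tdist_new_same by auto; congruence.
  1-3: intros u v hu hv; rewrite hp, tdist_new_other by auto;
       rewrite ?self, ?(sym b a), ?(sym c a), ?(sym c b), e01, e12, e02; reflexivity.
  (* The ends of a fresh segment are new trees, but at distance 0 from the old ones and hence equal
     to them in [Y]. *)
  assert (end0 : forall u v, (level X u <= n)%nat -> (level X v <= n)%nat ->
    p (Seg n u v 0) = p u).
  { intros u v hu hv; apply dist_eq0; rewrite hp, tdist_old_new by (auto; lra).
    rewrite self; ring. }
  assert (end1 : forall u v, (level X u <= n)%nat -> (level X v <= n)%nat ->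
    p (Seg n u v 1) = p v).
  { intros u v hu hv; apply dist_eq0; rewrite hp, tdist_old_new by (auto; lra).
    rewrite self; ring. }
  rewrite end0 in sa by auto; rewrite end1 in sb, sc by auto; eauto.
Qed.

(** Coinciding points are completed to a distinct triple, so circles are needed only through
    distinct points. *)
Lemma distinct_triple {Y : Type} (p q r : Y) (P : Y -> Y -> Y -> Prop) :
  p <> q -> q <> r -> p <> r ->
  (forall a b c, a <> b -> b <> c -> a <> c -> P a b c) ->
  forall a b c, exists a' b' c', P a' b' c' /\
    (a = a' \/ a = b' \/ a = c') /\ (b = a' \/ b = b' \/ b = c') /\ (c = a' \/ c = b' \/ c = c').
Proof.
  intros pq qr pr hP a b c.
  (* Two points cannot exhaust the three distinct points [p], [q], [r]. *)
  assert (new : forall u v : Y, exists w, u <> w /\ v <> w).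
  { intros u v.
    destruct (classic (u = p \/ v = p)) as [hp|hp]; [| exists p; tauto].
    destruct (classic (u = q \/ v = q)) as [hq|hq]; [| exists q; tauto].
    exists r; destruct hp, hq; subst; split; congruence. }
  assert (two : forall u v, u <> v -> exists w, P u v w).
  { intros u v huv; destruct (new u v) as [w [h h']]; exists w; auto. }
  destruct (classic (a = b)) as [<-|ab].
  - destruct (classic (a = c)) as [<-|ac].
    + destruct (new a a) as [v [h _]]; destruct (two a v h) as [w hw].
      exists a, v, w; tauto.
    + destruct (two a c ac) as [w hw]; exists a, c, w; tauto.
  - destruct (classic (b = c)) as [<-|bc].
    + destruct (two a b ab) as [w hw]; exists a, b, w; tauto.
    + destruct (classic (a = c)) as [<-|ac].
      * destruct (two a b ab) as [w hw]; exists a, b, w; tauto.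
      * exists a, b, c; split; [auto | tauto].
Qed.

(** * Assembly of the embedding and the degenerate spaces *)

Lemma embedding_of_two_points (X : MetricSpace) (x y : X) :
  Ptolemy X -> x <> y ->
  exists (Y : MetricSpace) (f : X -> Y),
    Ptolemy Y /\ isometric_embedding f /\
    forall a b c : Y, exists sigma : Y -> Prop,
      is_circle sigma /\ sigma a /\ sigma b /\ sigma c.
Proof.
  intros hX xy.
  pose proof (ptolemaic_tdist X hX) as ht.
  destruct (metric_quotient (tree X) (tdist X) ht (tdist_triangle X hX)) as [Y [p [surj hp]]].
  exists Y, (fun u => p (Leaf u)); repeat split.
  - intros a b c e.
    destruct (surj a) as [a' <-], (surj b) as [b' <-], (surj c) as [c' <-], (surj e) as [e' <-].
    rewrite !hp; apply (pt_ineq _ ht).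
  - intros u v; rewrite hp; apply tdist_leaf.
  - assert (hxy : 0 < dist x y).
    { destruct (dist_nonneg _ x y) as [|e]; auto; exfalso; apply xy, dist_eq0; auto. }
    (* The midpoint of an added segment supplies a third point, at distance [dist x y / 2] from both
       ends, even if [X] has only two points. *)
    set (z := Seg 0 (Leaf x) (Leaf y) (1 / 2)).
    assert (nz : forall u v, tdist X u v <> 0 -> p u <> p v).
    { intros u v h e; apply h; rewrite <- hp, e; apply dist_self. }
    assert (dz : forall u : X, tdist X z (Leaf u) = (1 - 1 / 2) * dist x u + 1 / 2 * dist y u).
    { intros u; unfold z; rewrite tdist_old_new by (auto; lra); reflexivity. }
    intros a b c.
    destruct (distinct_triple (p (Leaf x)) (p (Leaf y)) (p z)
      (fun a b c => exists sigma : Y -> Prop, is_circle sigma /\ sigma a /\ sigma b /\ sigma c))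
      with (a := a) (b := b) (c := c)
      as [a' [b' [c' [[sigma [hs [sa [sb sc]]]] [ha [hb hc]]]]]].
    + apply nz; rewrite tdist_leaf; lra.
    + apply not_eq_sym, nz; rewrite dz, dist_self; lra.
    + apply not_eq_sym, nz; rewrite dz, dist_self, (dist_sym _ y x); lra.
    + intros u v w; destruct (surj u) as [u' <-], (surj v) as [v' <-], (surj w) as [w' <-].
      apply tree_triangle_circle; auto.
    + exists sigma; split; auto.
      repeat split; [destruct ha as [->|[->| ->]] | destruct hb as [->|[->| ->]]
        | destruct hc as [->|[->| ->]]]; auto.
Qed.

Definition real_line : MetricSpace.
Proof.
  refine {| carrier := R; dist := fun x y => Rabs (x - y) |}.
  - intros; apply Rabs_pos.
  - intros; rewrite Rminus_diag; apply Rabs_R0.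
  - intros x y h; destruct (Req_dec (x - y) 0) as [|n]; [lra |].
    exfalso; exact (Rabs_no_R0 _ n h).
  - intros; apply Rabs_minus_sym.
  - intros x y z; replace (x - z) with ((x - y) + (y - z)) by ring; apply Rabs_triang.
Defined.

Theorem theorem2p8 :
  forall X : MetricSpace, Ptolemy X ->
    exists (Y : MetricSpace) (f : X -> Y),
      Ptolemy Y /\ isometric_embedding f /\
      forall a b c : Y, exists sigma : Y -> Prop,
        is_circle sigma /\ sigma a /\ sigma b /\ sigma c.
Proof.
  intros X hX.
  destruct (classic (exists x y : X, x <> y)) as [[x [y h]]|h].
  - exact (embedding_of_two_points X x y hX h).
  (* A space with at most one point, possibly empty, is sent to a single point of the space built
     from the real line. *)
  - assert (hR : Ptolemy real_line) by (intros r s t u; apply line_ptolemy).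
    destruct (embedding_of_two_points real_line 0 1 hR) as [Y [f [hY [_ hc]]]].
    { simpl; lra. }
    exists Y, (fun _ => f 0); split; [| split]; auto.
    intros a b; replace b with a by (apply NNPP; eauto).
    rewrite !dist_self; reflexivity.
Qed.
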